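(* Let $f:[a,b]\to\mathbb R$ be bounded, with a finite number of local maximum points, local minimum points, and discontinuity points, and with $\mathcal{ER}(f)=[\inf_{[a,b]}f,\sup_{[a,b]}f]$. Let $\{\Lambda_n=\{\lambda_{1,n},\ldots,\lambda_{d_n,n}\}\}_n$ be a sequence of finite multisets of real numbers with $d_n\to\infty$, such that $\{\Lambda_n\}_n$ has an asymptotic distribution described by $f$ and $\Lambda_n\subseteq f([a,b])$ for every $n$. Then there exist an asymptotically uniform grid $\{x_{i,n}\}_{i=1,\ldots,d_n}$ in $[a,b]$ with $\{x_{i,n}\}_{i=1,\ldots,d_n}\subset[a,b]$ and, for every $n$, a permutation $\tau_n$ of $\{1,\ldots,d_n\}$ such that $\lambda_{\tau_n(i),n}=f(x_{i,n})$ for all $i=1,\ldots,d_n$.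
   Context: A point $x_0\in[a,b]$ is a local maximum (resp. minimum) point of $f$ if $f(x_0)\ge f(x)$ (resp. $f(x_0)\le f(x)$) for all $x$ in a neighborhood of $x_0$ in $[a,b]$ (non-strict inequalities; e.g. every point is such a point if $f$ is constant). For measurable $f:[a,b]\to\mathbb R$, $\mathcal{ER}(f)=\{z\in\mathbb R:\mu_1\{x:|f(x)-z|<\epsilon\}>0\ \forall\epsilon>0\}$. A sequence of points $\{x_{i,n}\}_{i=1,\ldots,d_n}$ with $d_n\to\infty$ is an asymptotically uniform grid in $[a,b]$ if $\max_{i}|x_{i,n}-(a+i(b-a)/d_n)|\to0$. $\{\Lambda_n\}_n$ has an asymptotic distribution described by $f$ if $\lim_{n}\frac1{d_n}\sum_{i=1}^{d_n}F(\lambda_{i,n})=\frac1{b-a}\int_a^bF(f(x))\,dx$ for every continuous $F:\mathbb C\to\mathbb C$ with bounded support. *)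

(* Defs.v *)
From HB Require Import structures.
From mathcomp Require Import all_boot all_order all_algebra all_fingroup.
From mathcomp Require Import all_classical all_reals all_analysis.
Unset Printing Implicit Defensive.
Import Order.TTheory GRing.Theory Num.Theory.
Import numFieldNormedType.Exports.
Local Open Scope classical_set_scope.
Local Open Scope ring_scope.

Definition Icc {R : realType} (a b : R) : set R := [set x | x \in `[a, b]].

Definition is_loc_max {R : realType} (f : R -> R) (a b x0 : R) : Prop :=
  x0 \in `[a, b] /\
  exists2 delta : R, 0 < delta &
    forall x, x \in `[a, b] -> `|x - x0| < delta -> f x <= f x0.

Definition is_loc_min {R : realType} (f : R -> R) (a b x0 : R) : Prop :=
  x0 \in `[a, b] /\
  exists2 delta : R, 0 < delta &
    forall x, x \in `[a, b] -> `|x - x0| < delta -> f x0 <= f x.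

Definition is_discont {R : realType} (f : R -> R) (a b x0 : R) : Prop :=
  x0 \in `[a, b] /\ ~ (f @ within (Icc a b) (nbhs x0) --> f x0).

Definition ess_range {R : realType} (f : R -> R) (a b : R) : set R :=
  [set z | forall eps : R, 0 < eps ->
     (0%E < (@lebesgue_measure R) (Icc a b `&` [set x | (`|f x - z| < eps)%R]))%E].

(* Complex numbers are represented as pairs (Re, Im) in R * R.
   {Lambda_n} (Lambda_n = lam n 0, ..., lam n (d n - 1)) has the asymptotic
   distribution described by f on [a,b]: for every continuous F : C -> C with
   bounded support, (1/d_n) sum_i F(lam_{i,n}) -> 1/(b-a) int_a^b F(f x) dx
   (the complex integral being taken componentwise). *)
Definition has_asymptotic_distribution {R : realType} (d : nat -> nat)
    (lam : forall n, 'I_(d n) -> R) (f : R -> R) (a b : R) : Prop :=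
  forall F : R * R -> R * R,
    continuous F -> bounded_set [set z | F z != 0] ->
    (fun n => (d n)%:R^-1 *: \sum_(i < d n) F (lam n i, 0))
      @ \oo -->
    ((b - a)^-1 *:
       (Rintegral (@lebesgue_measure R) (Icc a b) (fun x => (F (f x, 0)).1),
        Rintegral (@lebesgue_measure R) (Icc a b) (fun x => (F (f x, 0)).2))).

(* {x_{i,n}} (i = 1..d_n, stored as x n (i-1)) is an asymptotically uniform grid in [a,b]. *)
Definition asympt_uniform_grid {R : realType} (d : nat -> nat)
    (x : forall n, 'I_(d n) -> R) (a b : R) : Prop :=
  (fun n => \big[Num.max/0]_(i < d n)
       `|x n i - (a + (i.+1)%:R * (b - a) / (d n)%:R)|) @ \oo --> 0.

(* Main.v *)
Require Import Defs.

(** Match grid indices with the elements of Lambda_n by Hall's theorem, joining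
    i to j when lambda_j = f x for some x of [a, b] within eps of the i-th grid
    point.  Cut [a, b] into K equal cells.  On a cell free of extrema and
    discontinuities f takes interior points to interior points of the image of
    the cell, so a continuous test function supported in that image can equal 1
    on the image of almost all of the cell; hence the asymptotic distribution
    puts at least about d_n |W| / K elements of Lambda_n in the image of any
    union of |W| cells, except for a loss of one cell per special point.  In
    Hall's condition this loss is absorbed by enlarging the set of cells met by
    the given grid indices by more neighbouring cells than there are special
    points.  Cells being arbitrarily small, eps can be sent to 0 with n. *)

From HB Require Import structures.
From mathcomp Require Import all_boot all_order all_algebra all_fingroup.
From mathcomp Require Import boolp zify.

(** * Hall's marriage theorem for finite types *)

Section Hall.
Variables (T U : finType) (r : T -> U -> bool).

Definition nbr (A : {set T}) : {set U} := [set u | [exists t in A, r t u]].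

Lemma nbrP (A : {set T}) u : reflect (exists2 t, t \in A & r t u) (u \in nbr A).
Proof. by rewrite inE; apply: (iffP exists_inP). Qed.

Lemma nbrU (A C : {set T}) : nbr (A :|: C) = nbr A :|: nbr C.
Proof.
apply/setP => u; rewrite in_setU; apply/nbrP/orP.
  by move=> [t /setUP[] tA rtu]; [left|right]; apply/nbrP; exists t.
by move=> [] /nbrP[t tA rtu]; exists t; rewrite // in_setU tA ?orbT.
Qed.

(** Induction on [#|D|] in the manner of Halmos and Vaughan. Confining the values to [B] lets the
    induction hypothesis apply after some targets have been used up; [u0] supplies a value when [D]
    is empty. *)
Lemma hall_within (u0 : U) (D : {set T}) (B : {set U}) :
  (forall A : {set T}, A \subset D -> #|A| <= #|B :&: nbr A|) ->
  exists f : T -> U,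
    {in D &, injective f} /\ (forall t, t \in D -> r t (f t) && (f t \in B)).
Proof.
have [n] := ubnP #|D|; elim: n D B => // n IHn D B /ltnSE leDn hD.
have [->|[t tD]] := set_0Vmem D.
  by exists (fun=> u0); split=> [x y|x]; rewrite inE.
(* Either some proper nonempty [A] meets Hall's bound with equality, and [A] and [D :\: A] are
   matched separately into [B :&: nbr A] and [B :\: nbr A]; or every such [A] has a target to
   spare. *)
have [/existsP[A /and3P[AD A0 /eqP tight]]|/existsPn slack] :=
  boolP [exists A : {set T}, [&& A \proper D, A != set0 & #|A| == #|B :&: nbr A|]].
  have [f1 [inj1 r1]] : exists f : T -> U, {in A &, injective f} /\
      (forall t, t \in A -> r t (f t) && (f t \in B :&: nbr A)).
    apply: IHn => [|C CA]; first exact: leq_trans (proper_card AD) leDn.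
    have -> : B :&: nbr A :&: nbr C = B :&: nbr C.
      by rewrite -setIA (setIidPr (_ : nbr C \subset nbr A))// -(setUidPr CA) nbrU subsetUl.
    exact/hD/(subset_trans CA)/proper_sub.
  have [f2 [inj2 r2]] : exists f : T -> U, {in D :\: A &, injective f} /\
      (forall t, t \in D :\: A -> r t (f t) && (f t \in B :\: nbr A)).
    apply: IHn => [|C CDA].
      apply: leq_trans leDn; rewrite cardsD (setIidPr (proper_sub AD)).
      rewrite ltn_subrL card_gt0 A0 /= card_gt0; apply/set0Pn; by exists t.
    (* Hall's bound for the disjoint union [A :|: C], minus the equality for [A], leaves the bound
       for [C] among the targets outside [nbr A]. *)
    have disj : [disjoint A & C].
      by rewrite disjoint_sym disjoints_subset (subset_trans CDA)// setDE subsetIr.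
    have /hD : A :|: C \subset D.
      by rewrite subUset (proper_sub AD) (subset_trans CDA) ?subsetDl.
    rewrite cardsU (disjoint_setI0 disj) cards0 subn0 nbrU tight.
    rewrite -(cardsID (nbr A) (B :&: (nbr A :|: nbr C))) -[B :&: _ :&: nbr A]setIA setUK.
    rewrite leq_add2l => /leq_trans; apply; apply/subset_leq_card/subsetP => u.
    by rewrite !inE => /and3P[/negPf-> -> /=].
  exists (fun t => if t \in A then f1 t else f2 t); split=> [x y xD yD|x xD].
    case: ifPn => xA; case: ifPn => yA; [exact: inj1 | | |].
    - move=> eqf; have /r1 := xA; rewrite eqf => /andP[_].
      have /r2 : y \in D :\: A by rewrite inE yA.
      by rewrite !inE => /and3P[_ /negPf-> _]; rewrite andbF.
    - move=> eqf; have /r1 := yA; rewrite -eqf => /andP[_].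
      have /r2 : x \in D :\: A by rewrite inE xA.
      by rewrite !inE => /and3P[_ /negPf-> _]; rewrite andbF.
    - by apply: inj2; rewrite inE ?xA ?yA.
  case: ifPn => xA; first by have /r1/andP[->] := xA; case/setIP.
  by have /r2/andP[->] : x \in D :\: A by [rewrite inE xA]; case/setDP.
(* Without a tight subset, [t] may take any neighbour [u] in [B]: deleting [u] lowers each count by
   at most one, and each inequality was strict. *)
have /card_gt0P[u /setIP[uB /nbrP[t' /set1P-> rtu]]] : 0 < #|B :&: nbr [set t]|.
  by rewrite (leq_trans _ (hD _ _)) ?cards1// sub1set.
have [f [injf rf]] : exists f : T -> U, {in D :\ t &, injective f} /\
    (forall t', t' \in D :\ t -> r t' (f t') && (f t' \in B :\ u)).
  apply: IHn => [|A ADt]; first by rewrite (cardsD1 t) tD in leDn.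
  have [->|A0] := eqVneq A set0; first by rewrite cards0.
  have AD : A \proper D by exact: sub_proper_trans ADt (properD1 tD).
  have := slack A; rewrite AD A0 /= => neq.
  have := hD A (proper_sub AD); rewrite leq_eqVlt (negPf neq) /=.
  have -> : (B :\ u) :&: nbr A = (B :&: nbr A) :\ u by rewrite setIDAC.
  by rewrite (cardsD1 u (B :&: _)) => lt; move: lt; case: (u \in _) => //= /ltnW.
exists (fun x => if x == t then u else f x); split=> [x y xD yD|x xD].
  case: eqVneq => [->|xt]; case: eqVneq => [->//|yt].
  - have /rf : y \in D :\ t by rewrite !inE yt.
    by move=> /andP[_] + eqf; rewrite -eqf !inE eqxx.
  - have /rf : x \in D :\ t by rewrite !inE xt.
    by move=> /andP[_] + eqf; rewrite eqf !inE eqxx.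
  - by apply: injf; rewrite !inE ?xt ?yt.
case: eqVneq => [->|xt]; first by rewrite rtu.
by have /rf/andP[-> /setD1P[_ ->]] : x \in D :\ t by rewrite !inE xt.
Qed.

Lemma hall_marriage :
  (forall A : {set T}, #|A| <= #|nbr A|) ->
  exists2 f : T -> U, injective f & forall t, r t (f t).
Proof.
(* The default target for [hall_within] comes from Hall's bound on a singleton; an empty [T] is
   treated apart, since [U] may then be empty too. *)
move=> hallr; case: (pickP (fun _ : T => true)) => [t0 _|noT]; last first.
  have f : T -> U by move=> t; have := noT t.
  by exists f => t; have := noT t.
have /card_gt0P[u0 _] : 0 < #|nbr [set t0]|.
  by apply: leq_trans (hallr _); rewrite cards1.
have [A _|f [injf rf]] := @hall_within u0 setT setT; first by rewrite setTI.
exists f => [x y|t]; first exact: injf.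
by have /andP[] := rf t (in_setT t).
Qed.

End Hall.

(** * Neighbourhoods of sets of cells in the path ['I_K] *)

Section Spread.
Variables (K : nat).
Implicit Type U : {set 'I_K}.

(** The closed [g]-neighbourhood for the distance of indices; two additive inequalities avoid
    truncated subtraction. *)
Definition spread (g : nat) U : {set 'I_K} :=
  [set k : 'I_K | [exists u in U, (k <= u + g) && (u <= k + g)]].

Lemma spreadP g U (k : 'I_K) :
  reflect (exists2 u : 'I_K, u \in U & (k <= u + g) && (u <= k + g)) (k \in spread g U).
Proof. by rewrite inE; apply: (iffP exists_inP). Qed.

Lemma spread0 U : spread 0 U = U.
Proof.
apply/setP => k; apply/spreadP/idP => [[u uU]|kU].
  by rewrite !addn0 -eqn_leq => /eqP/val_inj->.
by exists k; rewrite // !addn0 leqnn.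
Qed.

(** A path is connected: if one more step added nothing, the neighbourhood would be stable under
    passing to adjacent indices and so contain everything. *)
Lemma spread_mono g U : U != set0 -> spread g U != setT ->
  #|spread g U| < #|spread g.+1 U|.
Proof.
move=> /set0Pn[u0 u0U] neqT; apply/proper_card/properP; split.
  apply/subsetP => k /spreadP[u uU /andP[ku uk]].
  by apply/spreadP; exists u; rewrite // !addnS !leqW.
apply: contrapT => noX; move/negP: neqT; apply.
have closed (k : 'I_K) : k \in spread g.+1 U -> k \in spread g U.
  by move=> k1; apply: contraT => k0; case: noX; exists k.
rewrite -subTset.
(* Induction on the distance [m] to [u0]: some [k'] at most one step from [k] lies within the
   previous distance. *)
have near m : forall k : 'I_K, k <= u0 + m -> u0 <= k + m -> k \in spread g U.
  elim: m => [|m IHm] k.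
    rewrite !addn0 => ku uk; apply/spreadP; exists u0 => //.
    by rewrite !(leq_trans _ (leq_addr _ _)).
  rewrite !addnS => ku uk.
  have [k' [k1 k2 kS Sk]] : exists k' : 'I_K,
      [/\ k' <= u0 + m, u0 <= k' + m, k <= k'.+1 & k' <= k.+1].
    have [lt|gt|eq] := ltngtP k u0.
    - have ltK : k.+1 < K by exact: leq_ltn_trans lt (ltn_ord u0).
      exists (Ordinal ltK); split=> /=; last exact: leqnn.
      + exact: leq_trans lt (leq_addr _ _).
      + by rewrite addSn.
      + exact: leq_trans (leqnSn _) (leqnSn _).
    - have ltK : k.-1 < K by exact: leq_ltn_trans (leq_pred _) (ltn_ord k).
      have kgt0 : 0 < k by exact: leq_ltn_trans gt.
      exists (Ordinal ltK); split=> /=.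
      + by rewrite -ltnS prednK.
      + by rewrite (leq_trans _ (leq_addr _ _))// -ltnS prednK.
      + by rewrite prednK.
      + exact: leq_trans (leq_pred _) (leqnSn _).
    - by exists k; rewrite eq !leq_addr leqnSn.
  have /spreadP[u uU /andP[k'u uk']] := IHm _ k1 k2.
  apply/closed/spreadP; exists u => //; rewrite !addnS.
  by rewrite (leq_trans kS)// (leq_trans uk')// -addSn leq_add2r.
apply/subsetP => k _; apply: (near K); apply: leq_trans (leq_addl _ _);
  exact/ltnW/ltn_ord.
Qed.

(** Each unit of radius adds at least one cell, because a neighbourhood that is not full at radius
    [g] is not full at any smaller radius. *)
Lemma card_spread g U : U != set0 ->
  spread g U != setT -> #|U| + g <= #|spread g U|.
Proof.
move=> U0; elim: g => [|g IHg]; first by rewrite spread0 addn0.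
have [E|gT _] := eqVneq (spread g U) setT; last first.
  by rewrite addnS (leq_ltn_trans (IHg gT))// spread_mono.
case/eqP; apply/eqP; rewrite -subTset -E.
apply/subsetP => k /spreadP[u uU /andP[ku uk]].
by apply/spreadP; exists u; rewrite // !addnS !leqW.
Qed.

End Spread.

(* Integral bounds and test functions on the line *)
From mathcomp Require Import all_classical all_reals all_analysis.
From mathcomp Require Import lra ring.
Import Order.TTheory GRing.Theory Num.Theory.
Import numFieldNormedType.Exports.
Local Open Scope classical_set_scope.
Local Open Scope ring_scope.

Lemma measure_le_Rintegral {dT} {T : measurableType dT} {R : realType}
    (mu : {measure set T -> \bar R}) (D W : set T) (g : T -> R) :
  measurable D -> measurable W -> W `<=` D -> (mu D < +oo)%E ->
  (forall x, 0 <= g x <= 1) -> (forall x, W x -> g x = 1) ->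
  fine (mu W) <= Rintegral mu D g.
Proof.
move=> mD mW WD Doo g01 g1.
have indI A (mA : measurable A) : A `<=` D -> (\int[mu]_(x in D) (\1_A x)%:E = mu A)%E.
  by move=> AD; rewrite integral_indic// setIidl.
(* The integral of a nonnegative function is a supremum over the simple functions below it, so it is
   monotone even where measurability of [g] is unknown. *)
have le_int (h k : T -> \bar R) : (forall x, 0 <= h x)%E -> (forall x, h x <= k x)%E ->
    (\int[mu]_(x in D) h x <= \int[mu]_(x in D) k x)%E.
  move=> h0 hk; rewrite !ge0_integralE//; last by move=> x _; exact: le_trans (hk x).
  apply: le_ereal_sup => _ [s sh <-]; exists s => // x; apply: le_trans (sh x) _.
  by rewrite !patchE; case: ifP.
have le1 : (\int[mu]_(x in D) (g x)%:E <= mu D)%E.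
  rewrite -(indI D mD)//.
  rewrite [leRHS](eq_integral (fun=> 1%E)); last first.
    by move=> x xD; rewrite indicE xD.
  by apply: le_int => x; rewrite lee_fin; have /andP[] := g01 x.
rewrite /Rintegral fine_le//.
- by rewrite ge0_fin_numE// (le_lt_trans _ Doo)// le_measure// inE.
- rewrite ge0_fin_numE ?(le_lt_trans le1)//.
  by apply: integral_ge0 => x _; rewrite lee_fin; have /andP[] := g01 x.
rewrite -(indI W mW WD); apply: le_int => x; rewrite lee_fin// indicE.
by case: (boolP (x \in W)) => [/set_mem/g1->//|_]; have /andP[] := g01 x.
Qed.

(** [f] maps [[s, t]] onto [[f xm, f xM]], and in the absence of interior extrema its values on
    [[s', t']] stay strictly inside. This leaves room for a trapezoid equal to 1 on [[f ym, f yM]]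
    and to 0 outside []f xm, f xM[]. *)
Lemma cell_test_function {R : realType} (f : R -> R) (s s' t' t : R) :
  s < s' -> s' <= t' -> t' < t ->
  {within `[s, t], continuous f} ->
  (forall x, s < x < t -> ~ (exists2 e, 0 < e & forall y, `|y - x| < e -> f y <= f x)) ->
  (forall x, s < x < t -> ~ (exists2 e, 0 < e & forall y, `|y - x| < e -> f x <= f y)) ->
  exists rho : R -> R, [/\ continuous rho, (forall y, 0 <= rho y <= 1),
    (forall y, rho y != 0 -> exists2 x, x \in `[s, t] & f x = y) &
    (forall x, x \in `[s', t'] -> rho (f x) = 1)].
Proof.
move=> ss st tt cf nomax nomin.
have [xM xMI maxM] := EVT_max (ltW (lt_le_trans ss (le_trans st (ltW tt)))) cf.
have [xm xmI minm] := EVT_min (ltW (lt_le_trans ss (le_trans st (ltW tt)))) cf.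
have cf' : {within `[s', t'], continuous f}.
  apply: continuous_subspaceW cf => x /=; rewrite !in_itv/= => /andP[? ?].
  by apply/andP; split; lra.
have [yM yMI maxM'] := EVT_max st cf'.
have [ym ymI minm'] := EVT_min st cf'.
have interior y : y \in `[s', t'] -> s < y < t.
  by rewrite in_itv/= => /andP[? ?]; apply/andP; split; lra.
have nearI y : y \in `[s', t'] -> exists2 e, 0 < e & forall z, `|z - y| < e -> z \in `[s, t].
  rewrite in_itv/= => /andP[? ?]; exists (Num.min (s' - s) (t - t')).
    by rewrite lt_min !subr_gt0 ss tt.
  move=> z; rewrite lt_min !ltr_norml in_itv/= => /andP[/andP[? ?] /andP[? ?]].
  by apply/andP; split; lra.
(* Otherwise the interior point [yM] would be a maximum over all of [[s, t]], hence a local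
   maximum. *)
have ltM : f yM < f xM.
  have yMo := interior _ yMI; rewrite ltNge; apply/negP => le.
  have [e e0 eI] := nearI _ yMI; case: (nomax _ yMo); exists e => // y /eI yI.
  exact: le_trans (maxM _ yI) le.
have ltm : f xm < f ym.
  have ymo := interior _ ymI; rewrite ltNge; apply/negP => le.
  have [e e0 eI] := nearI _ ymI; case: (nomin _ ymo); exists e => // y /eI yI.
  exact: le_trans le (minm _ yI).
have ivt v : f xm < v < f xM -> exists2 x, x \in `[s, t] & f x = v.
  move=> /andP[mv vM]; move: xMI xmI; rewrite !in_itv/= => /andP[? ?] /andP[? ?].
  have sub u w : s <= u -> w <= t -> {within `[u, w], continuous f}.
    move=> ? ?; apply: continuous_subspaceW cf => x /=; rewrite !in_itv/= => /andP[? ?].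
    by apply/andP; split; lra.
  have [le|le] := lerP xm xM.
    have [||c] := @IVT R f xm xM v le; [exact: sub | | ].
      by rewrite (min_idPl _) ?(max_idPr _) ?(ltW mv) ?(ltW vM)//; lra.
    by rewrite in_itv/= => /andP[? ?] fc; exists c => //; rewrite in_itv/=; apply/andP; split; lra.
  have [||c] := @IVT R f xM xm v (ltW le); [exact: sub | | ].
    by rewrite (min_idPr _) ?(max_idPl _) ?(ltW mv) ?(ltW vM)//; lra.
  by rewrite in_itv/= => /andP[? ?] fc; exists c => //; rewrite in_itv/=; apply/andP; split; lra.
(* The two ramps of the trapezoid: [p] rises from 0 at [f xm] to 1 at [f ym], and [q] falls from 1
   at [f yM] to 0 at [f xM]. *)
pose p y := (y - f xm) / (f ym - f xm); pose q y := (f xM - y) / (f xM - f yM).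
exists (fun y => Num.max 0 (Num.min 1 (Num.min (p y) (q y)))).
have cp : continuous p by move=> y; apply: cvgMl; apply: cvgB; [exact: cvg_id | exact: cvg_cst].
have cq : continuous q by move=> y; apply: cvgMl; apply: cvgB; [exact: cvg_cst | exact: cvg_id].
have dm : 0 < f ym - f xm by rewrite subr_gt0.
have dM : 0 < f xM - f yM by rewrite subr_gt0.
split=> [y|y|y|x xI].
- apply: (@continuous_max R R (fun=> 0) (fun y => Num.min 1 (Num.min (p y) (q y)))).
    exact: cvg_cst.
  apply: (@continuous_min R R (fun=> 1) (fun y => Num.min (p y) (q y))).
    exact: cvg_cst.
  by apply: (@continuous_min R R p q); [exact: cp|exact: cq].
- by rewrite le_max lexx /= ge_max ler01 ge_min lexx.
- move=> rho0; apply: ivt.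
  have : 0 < Num.max 0 (Num.min 1 (Num.min (p y) (q y))).
    by rewrite lt0r rho0 le_max lexx.
  by rewrite lt_max ltxx /= !lt_min ltr01 /= !pmulr_lgt0 ?invr_gt0// !subr_gt0.
- have p1 : 1 <= p (f x) by rewrite ler_pdivlMr// mul1r lerD2r minm'.
  have q1 : 1 <= q (f x) by rewrite ler_pdivlMr// mul1r lerD2l lerN2 maxM'.
  by rewrite (min_idPl _) ?(max_idPr _)// le_min p1.
Qed.

(** Passage from complex to real test functions: [psi] of the real part is multiplied by a tent in
    the imaginary part. The tent is 1 at 0, so values on the reals do not change, and it makes the
    support bounded. *)
Lemma asympt_test {R : realType} (a b : R) (f : R -> R) (d : nat -> nat)
    (lam : forall n, 'I_(d n) -> R) (psi : R -> R) (M : R) :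
  has_asymptotic_distribution d lam f a b ->
  continuous psi -> (forall y, psi y != 0 -> `|y| <= M) ->
  (fun n => (d n)%:R^-1 * \sum_(i < d n) psi (lam n i)) @ \oo -->
  (b - a)^-1 * Rintegral (@lebesgue_measure R) (Icc a b) (psi \o f).
Proof.
move=> dist cpsi psiM.
pose chi (t : R) := Num.max 0 (1 - `|t|).
pose F (z : R * R) : R * R := (psi z.1 * chi z.2, 0).
have chi0 : chi 0 = 1 by rewrite /chi normr0 subr0 (max_idPr _).
have cchi : continuous chi.
  move=> t; apply: (@continuous_max R R (fun=> 0) (fun t => 1 - `|t|)).
    exact: cvg_cst.
  by apply: cvgB; [exact: cvg_cst | exact: norm_continuous].
have cF : continuous F.
  move=> z; apply: (@cvg_pair (R * R)%type R R (nbhs z)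
    (nbhs (psi z.1 * chi z.2)) (nbhs (0 : R)) _ _ _
    (fun z => psi z.1 * chi z.2) (fun=> 0)); last exact: cvg_cst.
  apply: (@continuousM R (R * R)%type (psi \o fst) (chi \o snd)).
    by apply: continuous_comp; [exact: cvg_fst | exact: cpsi].
  by apply: continuous_comp; [exact: cvg_snd | exact: cchi].
have bF : bounded_set [set z | F z != 0].
  exists (Num.max M 1); split; first exact: num_real.
  move=> N ltN [y t] /= Fz; have : psi y * chi t != 0.
    by apply: contra Fz => /eqP E; rewrite /F /= E.
  rewrite mulf_eq0 negb_or => /andP[psi0 chi0'].
  move: ltN; rewrite gt_max => /andP[MN N1]; rewrite prod_normE /= ge_max.
  rewrite (le_trans (psiM _ psi0) (ltW MN)) /=.
  rewrite (le_trans _ (ltW N1))// leNgt; apply: contra chi0' => t1.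
  by rewrite /chi (max_idPl _)// subr_le0 ltW.
have := dist F cF bF.
set lim := _ *: _ => distF.
have : (fun n => ((d n)%:R^-1 *: \sum_(i < d n) F (lam n i, 0)).1) @ \oo --> lim.1.
  exact: (cvg_comp _ fst distF (@cvg_fst R R (nbhs lim.1) (nbhs lim.2) _)).
have -> : lim.1 = (b - a)^-1 * Rintegral (@lebesgue_measure R) (Icc a b) (psi \o f).
  by congr (_ * _); apply: eq_Rintegral => x _; rewrite [LHS]/= chi0 mulr1.
have -> // : (fun n => ((d n)%:R^-1 *: \sum_(i < d n) F (lam n i, 0)).1) =
    (fun n => (d n)%:R^-1 * \sum_(i < d n) psi (lam n i)).
apply/funext => n; rewrite [LHS]/=; congr (_ * _).
rewrite (big_morph fst (id1 := 0) (op1 := +%R))//=.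
by apply: eq_bigr => i _; rewrite chi0 mulr1.
Qed.

Lemma within_continuous_sub {R : realType} (f : R -> R) (A B : set R) :
  B `<=` A -> (forall x, B x -> f @ within A (nbhs x) --> f x) ->
  {within B, continuous f}.
Proof.
move=> BA cf; apply/subspace_continuousP => x Bx U /(cf x Bx).
by rewrite /nbhs /= /within /= /nbhs /=; apply: filterS => y Uy /BA.
Qed.

(** Open cells are disjoint, so sending a hit cell to the position of the first point of [sp] inside
    it is injective. *)
Lemma card_cells_hit {R : realType} (t : nat -> R) (K : nat) (sp : seq R) :
  {homo t : m n / (m <= n)%N >-> m <= n} ->
  (#|[set k : 'I_K | has (fun x => (t k < x < t k.+1)%R) sp]%SET| <= size sp)%N.
Proof.
move=> tmono; set A := [set k | _]%SET.
have [n0|] := posnP (size sp).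
  rewrite n0 leqn0 cards_eq0; apply/eqP/setP => k.
  by rewrite !inE (size0nil n0).
case E : (size sp) => [//|n] _.
pose idx (k : 'I_K) : 'I_n.+1 := inord (find (fun x => (t k < x < t k.+1)%R) sp).
rewrite -[n.+1]card_ord -(card_in_imset (f := idx) (D := A)) ?max_card// => j k.
rewrite !inE => hj hk /(congr1 val); rewrite /= !inordK -?E -?has_find// => eqjk.
have := nth_find 0 hj; have := nth_find 0 hk; rewrite eqjk.
move=> /andP[k1 k2] /andP[j1 j2]; apply/val_inj/eqP; rewrite eqn_leq /=.
by apply/andP; split; rewrite leqNgt; apply/negP => /tmono lt;
  [have := lt_trans j1 k2|have := lt_trans k1 j2]; rewrite ltNge lt.
Qed.

(** * The [K] equal cells of [[a, b]] and test functions for their images *)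

Definition node {R : realType} (a b : R) (K k : nat) : R :=
  a + k%:R * ((b - a) / K%:R).

Lemma nodeS {R : realType} (a b : R) (K k : nat) :
  node a b K k.+1 = node a b K k + (b - a) / K%:R.
Proof. by rewrite /node -addn1 natrD; ring. Qed.

Lemma node0 {R : realType} (a b : R) (K : nat) : node a b K 0 = a.
Proof. by rewrite /node; ring. Qed.

Lemma node_last {R : realType} (a b : R) (K : nat) : (0 < K)%N -> node a b K K = b.
Proof. by move=> K0; rewrite /node mulrC divfK ?pnatr_eq0 -?lt0n//; ring. Qed.

Lemma node_homo {R : realType} (a b : R) (K : nat) : a <= b ->
  {homo node a b K : m n / (m <= n)%N >-> m <= n}.
Proof.
by move=> ab m n mn; rewrite /node lerD2l ler_wpM2r ?ler_nat ?divr_ge0 ?subr_ge0.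
Qed.

(** If no cell contained [x], induction on [k] would place every node before the last at or below
    [x], and then the last cell would contain it. *)
Lemma node_cover {R : realType} (a b x : R) (K : nat) : (0 < K)%N ->
  x \in `[a, b] -> exists k : 'I_K, x \in `[node a b K k, node a b K k.+1].
Proof.
move=> K0; rewrite in_itv/= => /andP[ax xb]; apply: contrapT => nok.
have above k : (k < K)%N -> node a b K k <= x.
  elim: k => [|k IHk] kK; first by rewrite node0.
  rewrite leNgt; apply/negP => xk; apply: nok; exists (Ordinal (ltnW kK)).
  by rewrite in_itv/= (IHk (ltnW kK)) ltW.
have K1 : (K.-1 < K)%N by rewrite prednK.
by apply: nok; exists (Ordinal K1); rewrite in_itv/= above//= prednK// node_last.
Qed.

Lemma node_sub {R : realType} (a b x : R) (K : nat) (k : 'I_K) : a <= b ->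
  x \in `[node a b K k, node a b K k.+1] -> x \in `[a, b].
Proof.
move=> ab; have K0 : (0 < K)%N by exact: leq_ltn_trans (ltn_ord k).
have := node_homo a b K ab _ _ (leq0n k); have := node_homo a b K ab _ _ (ltn_ord k).
rewrite node0 node_last// !in_itv/= => kb ak /andP[kx xk].
by rewrite (le_trans ak kx) (le_trans xk kb).
Qed.

(** The test functions of the single cells are summed and capped at 1. On each cell of [W] without
    special interior point the composite with [f] is 1 on a central part, a fraction [1 - kappa] of
    the cell; at most [size sp] cells are lost. *)
Lemma cells_test_function {R : realType} (a b : R) (f : R -> R) (sp : seq R)
    (K : nat) (kappa : R) (W : {set 'I_K}) :
  a < b -> (0 < K)%N -> 0 < kappa < 1 ->
  (forall x, is_loc_max f a b x -> x \in sp) ->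
  (forall x, is_loc_min f a b x -> x \in sp) ->
  (forall x, is_discont f a b x -> x \in sp) ->
  exists psi : R -> R, [/\ continuous psi, (forall y, 0 <= psi y <= 1),
    (forall y, psi y != 0 -> exists2 k : 'I_K, k \in W &
       exists2 x, x \in `[node a b K k, node a b K k.+1] & f x = y) &
    (1 - kappa) * (#|W|%:R - (size sp)%:R) / K%:R <=
      (b - a)^-1 * Rintegral (@lebesgue_measure R) (Icc a b) (psi \o f)].
Proof.
move=> ab K0 /andP[kap0 kap1] spmax spmin spdis.
pose h := (b - a) / K%:R; pose t := node a b K.
have h0 : 0 < h by rewrite divr_gt0 ?subr_gt0// ltr0n.
have tS k : t k.+1 = t k + h by exact: nodeS.
have tmono : {homo t : m n / (m <= n)%N >-> m <= n} by exact: node_homo (ltW ab).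
have tab k : (k < K)%N -> a <= t k /\ t k.+1 <= b.
  move=> kK; have := tmono _ _ (leq0n k); have := tmono _ _ kK.
  by rewrite /t node0 node_last.
have kh : 0 < kappa * h by rewrite mulr_gt0.
have kh1 : kappa * h < h by rewrite gtr_pMl.
pose bad := [set k : 'I_K | has (fun x => (t k < x < t k.+1)%R) sp]%SET.
have /choice[rho rhoP] (k : 'I_K) : exists rho : R -> R,
    [/\ continuous rho, (forall y, 0 <= rho y <= 1),
    (forall y, rho y != 0 -> exists2 x, x \in `[t k, t k.+1] & f x = y) &
    (k \notin bad -> forall x, x \in `[t k + kappa * h / 2, t k.+1 - kappa * h / 2] ->
       rho (f x) = 1)].
  case: (boolP (k \in bad)) => [_|].
    exists (fun=> 0); split=> //; first by move=> y; exact: cvg_cst.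
    - by move=> y; rewrite lexx ler01.
    - by move=> y; rewrite eqxx.
  rewrite inE => /hasPn nsp; have [ta tb] := tab _ (ltn_ord k); have tSk := tS k.
  have out x : t k < x < t k.+1 -> x \notin sp.
    by move=> xt; apply/negP => /nsp; rewrite xt.
  have sub x : t k < x < t k.+1 -> x \in `[a, b].
    by rewrite in_itv/= => /andP[? ?]; apply/andP; split; lra.
  (* The margins [kappa * h / 4] keep the closed interval off the nodes, which may themselves be
     special points; the inner interval gives up [kappa * h / 2] at each end. *)
  have [||||||rho [crho rho01 rhoI rho1]] :=
    @cell_test_function R f (t k + kappa * h / 4) (t k + kappa * h / 2)
      (t k.+1 - kappa * h / 2) (t k.+1 - kappa * h / 4).
  - lra.
  - lra.
  - lra.
  - apply: (@within_continuous_sub R f (Icc a b)) => x /=; rewrite in_itv/= => /andP[? ?].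
      by rewrite /Icc/= in_itv/=; apply/andP; split; lra.
    have xt : t k < x < t k.+1 by apply/andP; split; lra.
    apply: contrapT => ncvg; move/negP: (out _ xt); apply; apply: spdis.
    by split => //; exact: sub.
  - move=> x /andP[? ?] [e e0 xe]; have xt : t k < x < t k.+1 by apply/andP; split; lra.
    move/negP: (out _ xt); apply; apply: spmax; split; first exact: sub.
    by exists e => // y _; exact: xe.
  - move=> x /andP[? ?] [e e0 xe]; have xt : t k < x < t k.+1 by apply/andP; split; lra.
    move/negP: (out _ xt); apply; apply: spmin; split; first exact: sub.
    by exists e => // y _; exact: xe.
  exists rho; split=> // y /rhoI[x xI fxy]; exists x => //.
  by move: xI; rewrite !in_itv/= => /andP[? ?]; apply/andP; split; lra.
(* Images of different cells may overlap, so the bare sum could exceed 1. *)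
pose psi y := Num.min 1 (\sum_(k in W) rho k y).
have rho0 k y : 0 <= rho k y by have [_ /(_ y)/andP[]] := rhoP k.
have psi01 y : 0 <= psi y <= 1.
  by rewrite le_min ler01 sumr_ge0//= ge_min lexx.
exists psi; split=> //.
- move=> y; apply: (@continuous_min R R (fun=> 1) (fun y => \sum_(k in W) rho k y)).
    exact: cvg_cst.
  apply: cvg_big => [|k _]; first exact: add_continuous.
  by have [crho _ _ _] := rhoP k; exact: crho.
- move=> y psi0; apply: contrapT => noW; move/negP: psi0; apply.
  rewrite /psi big1 ?(min_idPr _)// => k kW; apply/eqP; apply: contrapT => /negP rk.
  by have [_ _ /(_ _ rk) ? _] := rhoP k; apply: noW; exists k.
(* The central parts are pairwise disjoint, so the region [S] where [psi \o f] is known to be 1 has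
   the sum of their lengths as measure. *)
pose J (k : 'I_K) : set R := `[t k + kappa * h / 2, t k.+1 - kappa * h / 2]%classic.
pose G := W :\: bad.
pose S := \big[setU/set0]_(k < K | k \in G) J k.
have mJ k : measurable (J k) by exact: measurable_itv.
have muJ k : lebesgue_measure (J k) = ((1 - kappa) * h)%:E.
  rewrite /J lebesgue_measure_itv /= lte_fin tS ifT; last by lra.
  by rewrite -EFinB; congr EFin; lra.
have muI : lebesgue_measure (Icc a b) = (b - a)%:E.
  by rewrite /Icc lebesgue_measure_itv /= lte_fin ab -EFinB.
have SP x : S x -> exists2 k, k \in G & J k x.
  by rewrite /S -bigcup_pred => -[k kG Jk]; exists k.
have muS : fine (lebesgue_measure S) = #|G|%:R * ((1 - kappa) * h).
  rewrite /S measure_bigsetU_ord_cond//; last first.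
  - apply/trivIsetP => i j _ _ ij; apply: contrapT => /eqP/set0P[x].
    rewrite /setI /J /= !in_itv /= => -[/andP[? ?] /andP[? ?]]; case/eqP: ij; apply/val_inj/eqP.
    rewrite eqn_leq /=; apply/andP; split; rewrite leqNgt; apply/negP => /tmono; lra.
  - by move=> k _; exact: mJ.
  rewrite (eq_bigr (fun=> ((1 - kappa) * h)%:E)) => [|k _]; last exact: muJ.
  by rewrite sumEFin /= sumr_const mulr_natl.
have : fine (lebesgue_measure S) <= Rintegral (@lebesgue_measure R) (Icc a b) (psi \o f).
  apply: measure_le_Rintegral => //.
  - by rewrite /Icc; exact: measurable_itv.
  - by apply: bigsetU_measurable => k _; exact: mJ.
  - move=> x /SP[k _]; rewrite /J/= in_itv/= => /andP[? ?].
    have [? ?] := tab _ (ltn_ord k); rewrite /Icc /= in_itv/=.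
    by apply/andP; split; lra.
  - by have := ltry (b - a); rewrite -muI.
  - by move=> x; exact: psi01.
  move=> x /SP[k kG Jx]; move: kG; rewrite inE => /andP[kbad kW].
  have [_ _ _ /(_ kbad x Jx) r1] := rhoP k.
  rewrite /= /psi (min_idPl _)// (bigD1 k)//= r1 lerDl sumr_ge0//.
rewrite muS => le; rewrite -(ler_pM2l (_ : 0 < (b - a)^-1)) in le; last first.
  by rewrite invr_gt0 subr_gt0.
apply: le_trans le.
have -> : (b - a)^-1 * (#|G|%:R * ((1 - kappa) * h)) = (1 - kappa) * #|G|%:R / K%:R.
  rewrite /h; field. by rewrite pnatr_eq0 -lt0n K0 subr_eq0 gt_eqF.
rewrite ler_pM2r ?invr_gt0 ?ltr0n// ler_pM2l ?subr_gt0// lerBlDr -natrD ler_nat.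
rewrite -(cardsID bad W) addnC leq_add2l.
apply: leq_trans (card_cells_hit t K sp tmono); exact/subset_leq_card/subsetIr.
Qed.

(** * Counting the elements of [lam n] in the image of a union of cells *)

Definition hit_by_cells {R : realType} (a b : R) (f : R -> R) (m K : nat)
    (lam : 'I_m -> R) (W : {set 'I_K}) : {set 'I_m} :=
  [set j | `[< exists2 k : 'I_K, k \in W &
     exists2 x, x \in `[node a b K k, node a b K k.+1] & f x = lam j >]]%SET.

(** The test function [psi] is at most the indicator of the image of the cells, so its mean over
    [lam n] bounds the proportion of hit indices from below; counting indices respects
    multiplicities. There are finitely many [W], so one threshold in [n] serves all of them. *)
Lemma card_hit_by_cells {R : realType} (a b M : R) (f : R -> R)
    (d : nat -> nat) (lam : forall n, 'I_(d n) -> R) (sp : seq R) (K : nat) (eta : R) :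
  a < b -> (0 < K)%N -> 0 < eta ->
  (forall x, x \in `[a, b] -> `|f x| <= M) ->
  (forall x, is_loc_max f a b x -> x \in sp) ->
  (forall x, is_loc_min f a b x -> x \in sp) ->
  (forall x, is_discont f a b x -> x \in sp) ->
  has_asymptotic_distribution d lam f a b ->
  \forall n \near \oo, forall W : {set 'I_K},
    (d n)%:R * ((#|W|%:R - (size sp)%:R) / K%:R - eta) <=
      #|hit_by_cells a b f (d n) K (lam n) W|%:R :> R.
Proof.
move=> ab K0 eta0 fM spmax spmin spdis dist; apply: filter_forall => W.
(* One [eta / 2] pays for the factor [1 - kappa], the other for the gap between the mean and its
   limit; the cap [1 / 2] keeps [kappa] below 1. *)
pose kappa := Num.min (eta / 2) (1 / 2).
have kap0 : 0 < kappa by rewrite lt_min !divr_gt0.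
have kap_eta : kappa <= eta / 2 by rewrite ge_min lexx.
have kap1 : kappa < 1 by rewrite gt_min [1 / 2 < 1](_ : _ = true) ?orbT//; lra.
have kap01 : 0 < kappa < 1 by rewrite kap0.
have [psi [cpsi psi01 psiW intpsi]] :=
  @cells_test_function R a b f sp K kappa W ab K0 kap01 spmax spmin spdis.
have psiM y : psi y != 0 -> `|y| <= M.
  move=> /psiW[k _ [x xk <-]]; apply: fM.
  exact: node_sub (ltW ab) xk.
have cvgI := asympt_test a b f d lam psi M dist cpsi psiM.
set I := (b - a)^-1 * _ in cvgI intpsi.
have ltI : I - eta / 2 < I by lra.
have := @cvgr_ge _ _ _ eventually_filter _ _ cvgI _ ltI.
apply: filterS => n le_mean.
have hitE : \sum_(i < d n) psi (lam n i) <=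
    #|hit_by_cells a b f (d n) K (lam n) W|%:R :> R.
  rewrite -sum1_card natr_sum [leRHS]big_mkcond /=; apply: ler_sum => j _.
  case: ifPn => [_|]; first by have /andP[] := psi01 (lam n j).
  rewrite inE => /asboolPn nhit; rewrite le_eqVlt; apply/orP; left.
  by apply: contrapT => /negP /psiW.
apply: le_trans hitE; have [d0|dpos] := posnP (d n).
  by rewrite [in leLHS]d0 mul0r sumr_ge0// => j _; have /andP[] := psi01 (lam n j).
have dR : 0 < (d n)%:R :> R by rewrite ltr0n.
rewrite -ler_pdivlMl// (le_trans _ le_mean)//.
suff : (#|W|%:R - (size sp)%:R) / K%:R - kappa <= I by lra.
apply: le_trans intpsi.
have KR : 0 < K%:R :> R by rewrite ltr0n.
(* As this quotient is at most 1, multiplying it by [1 - kappa] costs at most [kappa], even when it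
   is negative. *)
have WK : (#|W|%:R - (size sp)%:R) / K%:R <= 1 :> R.
  rewrite ler_pdivrMr// mul1r lerBlDr -natrD ler_nat.
  by rewrite (leq_trans (max_card _))// card_ord leq_addr.
rewrite -mulrA; nra.
Qed.

(** * Matching grid points with [lam] for a fixed number of cells *)

Lemma card_quotient_cells (m K q : nat) (c : 'I_m -> 'I_K) (G : {set 'I_m}) :
  (0 < q)%N -> (forall i, c i = (i %/ q)%N :> nat) -> (#|G| <= #|c @: G| * q)%N.
Proof.
(* Quotient and remainder determine an index, so at most [q] indices share a cell. *)
move=> q0 cE; pose e (i : 'I_m) := (c i, Ordinal (ltn_pmod i q0)).
have inje : injective e.
  move=> i j [cij /= mij]; apply/val_inj.
  by rewrite /= (divn_eq i q) (divn_eq j q) -!cE cij mij.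
rewrite -(card_imset _ inje) -[q in leqRHS]card_ord -cardsT -cardsX.
apply/subset_leq_card/fintype.subsetP => _ /imsetP[i iG ->].
by rewrite finset.in_setX finset.in_setT andbT finset.imset_f.
Qed.

(** Blocks of [q] consecutive indices stand in for the cells. From [m <= q * K <= m + K], block [c]
    starts no earlier than cell [c] and may drift to the right; the bound on [K * K] stops the drift
    at node [c + 2]. *)
Lemma grid_near_node {R : realType} (a b : R) (m K q : nat) (i : 'I_m) :
  a < b -> (0 < K)%N -> (2 * (K * K) <= m)%N -> q = ((m %/ K).+1)%N ->
  node a b K (i %/ q)%N <= a + i.+1%:R * (b - a) / m%:R <=
    node a b K (i %/ q)%N + 2 * ((b - a) / K%:R).
Proof.
move=> ab K0 Km qE; set c := (i %/ q)%N.
have m0 : (0 < m)%N by exact: leq_ltn_trans (ltn_ord i).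
have q0 : (0 < q)%N by rewrite qE.
have mq : (m <= q * K)%N by rewrite qE ltnW// ltn_ceil.
have qm : (q * K <= m + K)%N by rewrite qE mulSn addnC leq_add2r leq_divM.
have ci : (c * q <= i)%N by exact: leq_divM.
have ic : (i < c.+1 * q)%N by exact: ltn_ceil.
have cK : (c < K)%N by rewrite ltn_divLR// mulnC (leq_trans (ltn_ord i)).
have lo : (c * m <= i.+1 * K)%N by nia.
have hi : (i.+1 * K <= c.+2 * m)%N by nia.
have mR : 0 < m%:R :> R by rewrite ltr0n.
have KR : 0 < K%:R :> R by rewrite ltr0n.
have L0 : 0 < b - a by rewrite subr_gt0.
have -> : i.+1%:R * (b - a) / m%:R = (i.+1 * K)%:R / m%:R * ((b - a) / K%:R) :> R.
  by rewrite natrM; field; rewrite !gt_eqF.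
have h0 : 0 < (b - a) / K%:R by rewrite divr_gt0.
rewrite /node lerD2l ler_pM2r// ler_pdivlMr// -natrM ler_nat lo /=.
rewrite -addrA lerD2l -mulrDl ler_pM2r// ler_pdivrMr// -natrD -natrM ler_nat.
by rewrite addn2.
Qed.

(** Hall's theorem for the relation [r]. Of the [B + 3] cell widths, [B + 1] come from spreading and
    2 from the drift between blocks and cells. Of the spread, [B] repays the special points and 1
    the rounding of [q] together with the error [(2 * K%:R)^-1]. *)
Lemma grid_matching {R : realType} (a b : R) (f : R -> R) (m K B : nat)
    (lam : 'I_m -> R) :
  a < b -> (0 < K)%N -> (2 * (K * K) <= m)%N ->
  (forall j, (f @` Icc a b) (lam j)) ->
  (forall W : {set 'I_K}, m%:R * ((#|W|%:R - B%:R) / K%:R - (2 * K%:R)^-1) <=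
      #|hit_by_cells a b f m K lam W|%:R :> R) ->
  exists x : 'I_m -> R, exists tau : {perm 'I_m}, forall i,
    [/\ x i \in `[a, b],
        `|x i - (a + i.+1%:R * (b - a) / m%:R)| <= (B + 3)%:R * ((b - a) / K%:R) &
        lam (tau i) = f (x i)].
Proof.
move=> ab K0 Km lamf hit.
pose g (i : 'I_m) := a + i.+1%:R * (b - a) / m%:R.
pose h := (b - a) / K%:R.
have h0 : 0 < h by rewrite divr_gt0 ?subr_gt0 ?ltr0n.
pose r (i j : 'I_m) := `[< exists x, [/\ x \in `[a, b],
  `|x - g i| <= (B + 3)%:R * h & f x = lam j] >].
pose q := ((m %/ K).+1)%N.
have q0 : (0 < q)%N by [].
have cK (i : 'I_m) : (i %/ q < K)%N.
  by rewrite ltn_divLR// mulnC (leq_trans (ltn_ord i))// ltnW// ltn_ceil.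
pose c (i : 'I_m) : 'I_K := Ordinal (cK i).
have hallr (G : {set 'I_m}) : (#|G| <= #|nbr _ _ r G|)%N.
  have [->|G0] := eqVneq G finset.set0; first by rewrite cards0.
  set W := spread K B.+1 (c @: G).
  have near_cells (k : 'I_K) x : k \in W ->
      x \in `[node a b K k, node a b K k.+1] ->
      exists2 i, i \in G & `|x - g i| <= (B + 3)%:R * h.
    move=> /spreadP[_ /imsetP[i iG ->] /andP[kc ck]]; rewrite in_itv/= => /andP[kx xk].
    exists i => //; have /andP[] := @grid_near_node R a b m K q i ab K0 Km erefl.
    rewrite -/(g i) -/h => lo hi.
    have kcR : k%:R <= (c i)%:R + (B%:R + 1) :> R by rewrite natr1 -natrD ler_nat.
    have ckR : (c i)%:R <= k%:R + (B%:R + 1) :> R by rewrite natr1 -natrD ler_nat.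
    move: kx xk lo hi; rewrite nodeS /node -/h => kx xk lo hi.
    have e1 : k%:R * h <= ((c i)%:R + (B%:R + 1)) * h by rewrite ler_pM2r.
    have e2 : (c i)%:R * h <= (k%:R + (B%:R + 1)) * h by rewrite ler_pM2r.
    move: lo hi e1 e2; rewrite /c /= natrD !mulrDl !mul1r => lo hi e1 e2.
    by rewrite ler_norml; apply/andP; split; lra.
  (* If the spread fills all cells, every [lam j] is a value of [f] on one of them, so every [j] is
     a neighbour of [G]. *)
  have [WT|WT] := eqVneq W finset.setT.
    rewrite (leq_trans (max_card _))// -cardsT subset_leq_card//.
    apply/fintype.subsetP => j _; have [x xI fx] := lamf j.
    have [k xk] := node_cover a b x K K0 xI.
    have [i iG xi] := near_cells k x ltac:(by rewrite WT inE) xk.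
    by apply/nbrP; exists i => //; apply/asboolP; exists x.
  have U0 : c @: G != finset.set0.
    by have /finset.set0Pn[i iG] := G0; apply/finset.set0Pn; exists (c i); rewrite imset_f.
  have UW := card_spread K B.+1 _ U0 WT; rewrite -/W in UW.
  have sub : hit_by_cells a b f m K lam W \subset nbr _ _ r G.
    apply/fintype.subsetP => j; rewrite inE => /asboolP[k kW [x xk fx]].
    have [i iG xi] := near_cells k x kW xk.
    apply/nbrP; exists i => //; apply/asboolP; exists x; split=> //.
    exact: node_sub (ltW ab) xk.
  have GU := card_quotient_cells m K q c G q0 (fun=> erefl).
  apply: leq_trans (subset_leq_card sub).
  rewrite -(ler_nat R); apply: le_trans (hit W).
  have UK : (#|c @: G| <= K)%N by rewrite -[leqRHS]card_ord max_card.
  have qm : (q * K <= m + K)%N by rewrite mulSn addnC leq_add2r leq_divM.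
  move: GU UW UK; set u := #|c @: G| => GU UW UK.
  have KR : 0 < K%:R :> R by rewrite ltr0n.
  have -> : m%:R * ((#|W|%:R - B%:R) / K%:R - (2 * K%:R)^-1) =
      m%:R * (2 * (#|W|%:R - B%:R) - 1) / (2 * K%:R) :> R.
    by field; rewrite gt_eqF.
  rewrite ler_pdivlMr ?mulr_gt0//.
  (* |U| q K <= |U| (m + K) and 2 |U| K <= 2 K^2 <= m, while |W| >= |U| + B + 1. *)
  have : (#|G| * (2 * K) + m * (2 * B + 1) <= m * (2 * #|W|))%N by nia.
  rewrite -(ler_nat R) !natrD !natrM natrD natrM; lra.
have [tau injtau rtau] := hall_marriage _ _ r hallr.
have /choice[x xP] i : exists x, [/\ x \in `[a, b],
  `|x - g i| <= (B + 3)%:R * h & f x = lam (tau i)] by have /asboolP := rtau i.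
by exists x, (perm injtau) => i; have [? ? ->] := xP i; split=> //; rewrite permE.
Qed.

(** * Letting the tolerance tend to 0 with [n] *)

Lemma ex_least_level {R : realType} (P : R -> Prop) (e : nat -> R) (n : nat) :
  {homo e : j k / (j <= k)%N >-> k <= j} -> P (e 0%N) ->
  exists k, P (e k) /\ forall j, (j <= n)%N -> P (e j) -> e k <= e j.
Proof.
(* As [e] is nonincreasing, the largest index up to [n] that satisfies [P] gives the least level;
   index 0 guarantees that there is one. *)
move=> edec P0; pose Q k := (k <= n)%N && `[< P (e k) >].
have exQ : exists k, Q k by exists 0%N; apply/andP; split => //; exact/asboolP.
have Qn k : Q k -> (k <= n)%N by case/andP.
have [k /andP[_ /asboolP Pk] kmax] := ex_maxnP exQ Qn.
exists k; split=> // j jn Pj; apply/edec/kmax/andP; split=> //; exact/asboolP.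
Qed.

Theorem theorem2p6 (R : realType) (a b : R) (f : R -> R)
  (d : nat -> nat) (lam : forall n, 'I_(d n) -> R) :
  a < b ->
  (exists M : R, forall x, x \in `[a, b] -> `|f x| <= M) ->
  finite_set [set x0 | is_loc_max f a b x0] ->
  finite_set [set x0 | is_loc_min f a b x0] ->
  finite_set [set x0 | is_discont f a b x0] ->
  ess_range f a b = [set z | z \in `[inf (f @` Icc a b), sup (f @` Icc a b)]] ->
  (forall M : nat, \forall n \near \oo, (M <= d n)%N) ->
  has_asymptotic_distribution d lam f a b ->
  (forall n (i : 'I_(d n)), (f @` Icc a b) (lam n i)) ->
  exists x : forall n, 'I_(d n) -> R,
    (forall n (i : 'I_(d n)), x n i \in `[a, b]) /\
    asympt_uniform_grid d x a b /\
    exists tau : forall n, {perm 'I_(d n)},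
      forall n (i : 'I_(d n)), lam n (tau n i) = f (x n i).
Proof.
move=> ab [M fM] finmax finmin findis _ dinf dist lamf.
have [sp [spmax spmin spdis]] : exists sp : seq R,
    [/\ forall x, is_loc_max f a b x -> x \in sp,
        forall x, is_loc_min f a b x -> x \in sp &
        forall x, is_discont f a b x -> x \in sp].
  have /finite_seqP[sp spE] : finite_set ([set x0 | is_loc_max f a b x0] `|`
      [set x0 | is_loc_min f a b x0] `|` [set x0 | is_discont f a b x0]).
    by rewrite !finite_setU.
  have insp x (xsp : [set` sp] x) : x \in sp by [].
  by exists sp; split=> x xs; apply: insp; rewrite -spE;
    [left; left | left; right | right].
pose B := size sp.
(* The tolerance given by [grid_matching] with [k + 1] cells. *)
pose e k : R := (B + 3)%:R * ((b - a) / k.+1%:R).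
have L0 : 0 < b - a by rewrite subr_gt0.
have edec : {homo e : j k / (j <= k)%N >-> k <= j}.
  move=> j k jk; rewrite /e ler_wpM2l// ler_wpM2l ?(ltW L0)//.
  by rewrite lef_pV2 ?posrE ?ltr0n// ler_nat ltnS.
pose g n (i : 'I_(d n)) := a + i.+1%:R * (b - a) / (d n)%:R.
pose P n (u : R) := exists x : 'I_(d n) -> R, exists tau : {perm 'I_(d n)}, forall i,
  [/\ x i \in `[a, b], `|x i - g n i| <= u & lam n (tau i) = f (x i)].
(* [e 0] is at least [b - a], the diameter of the interval, so arbitrary preimages with the identity
   permutation suffice. *)
have P0 n : P n (e 0%N).
  have /choice[x xP] : forall i, exists x, x \in `[a, b] /\ lam n i = f x.
    by move=> i; have [x xI fx] := lamf n i; exists x.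
  exists x, 1%g => i; have [xI fx] := xP i; rewrite perm1; split=> //.
  have dn : 0 < (d n)%:R :> R by rewrite ltr0n (leq_ltn_trans (leq0n i)).
  have gI : a <= g n i <= b.
    rewrite lerDl !mulr_ge0 ?invr_ge0 ?(ltW L0)//=.
    by rewrite -lerBrDl ler_pdivrMr// mulrC ler_pM2l// ler_nat.
  move: xI gI; rewrite in_itv/= => /andP[ax xb] /andP[ag gb].
  apply: (@le_trans _ _ (b - a)); first by rewrite ler_norml; apply/andP; split; lra.
  by rewrite /e divr1 ler_peMl ?(ltW L0)// ler1n addn3.
(* With [k] fixed, [d n] is eventually large enough and the count of hit indices holds with [eta]
   equal to half of [1 / (k + 1)]. *)
have Pe k : \forall n \near \oo, P n (e k).
  have k0 : 0 < (2 * k.+1%:R)^-1 :> R by rewrite invr_gt0 mulr_gt0.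
  have hit := @card_hit_by_cells R a b M f d lam sp k.+1 _ ab isT k0 fM spmax spmin spdis dist.
  near=> n; apply: grid_matching => //; near: n; [exact: dinf | exact: hit].
(* Diagonal choice without an explicit rate: a single matching has to respect every tolerance [e j]
   with [j <= n] that is attainable for this [n]. *)
pose good n (x : 'I_(d n) -> R) := exists tau : {perm 'I_(d n)}, forall i,
  [/\ x i \in `[a, b],
    forall j, (j <= n)%N -> P n (e j) -> `|x i - g n i| <= e j &
    lam n (tau i) = f (x i)].
have exgood n : exists x, good n x.
  have [k [[x [tau xP]] kbest]] := ex_least_level (P n) e n edec (P0 n).
  exists x, tau => i; have [xI xg lamx] := xP i; split=> // j jn Pj.
  exact: le_trans xg (kbest j jn Pj).
pose x n := sval (cid (exgood n)).
have xP n : good n (x n) := svalP (cid (exgood n)).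
exists x; split; [|split].
- by move=> n i; have [tau /(_ i)[]] := xP n.
(* Truncation makes [k + 1] exceed [(B + 3) * (b - a) / eps], which gives [e k <= eps]. *)
- apply/cvgrPdist_le => eps eps0; pose k := Num.truncn (eps^-1 * ((B + 3)%:R * (b - a))).
  have ek : e k <= eps.
    rewrite /e mulrA ler_pdivrMr ?ltr0n// -ler_pdivrMl//.
    by rewrite ltW// truncnS_gt.
  have ek0 : 0 <= e k by rewrite mulr_ge0// divr_ge0// ltW.
  near=> n; rewrite sub0r normrN.
  have kn : (k <= n)%N by near: n; exact: nbhs_infty_ge.
  have Pk : P n (e k) by near: n; exact: Pe.
  apply: le_trans ek; rewrite ger0_norm; last by apply: bigmax_ge_id.
  apply: bigmax_le => // i _; have [tau /(_ i)[_ xg _]] := xP n.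
  exact: xg.
- exists (fun n => sval (cid (xP n))) => n i.
  by have [] := svalP (cid (xP n)) i.
Unshelve. all: by end_near.
Qed.
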